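(* Suppose that $(\aleph_\omega)^{\aleph_0}=\aleph_{\omega+1}$ and Chang's conjecture $(\aleph_{\omega+1},\aleph_\omega)\twoheadrightarrow(\aleph_1,\aleph_0)$ holds. Then the partial order $([\aleph_\omega]^{\aleph_0},\subseteq)$ does not have the $\aleph_1$-FN.
   Context: $(\kappa,\lambda)\twoheadrightarrow(\mu,\nu)$ means: for every structure $\mathcal{A}=(A,U,\ldots)$ in a countable signature with $|A|=\kappa$, $U\subseteq A$ and $|U|=\lambda$, there is an elementary substructure $\mathcal{A}'=(A',U',\ldots)$ of $\mathcal{A}$ with $|A'|=\mu$ and $|U'|=\nu$. $[X]^{\aleph_0}$ is the set of countably infinite subsets of $X$. A partial order $P$ has the $\aleph_1$-FN if there is $f:P\to[P]^{<\aleph_1}$ (values countable subsets of $P$) such that whenever $p\leq q$ there is $r\in f(p)\cap f(q)$ with $p\leq r\leq q$. *)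

(* Defs.v *)
From HB Require Import structures.
From mathcomp Require Import all_boot all_order.
From mathcomp Require Import boolp classical_sets functions cardinality.

Set Implicit Arguments.
Unset Strict Implicit.
Unset Printing Implicit Defensive.

Local Open Scope classical_set_scope.
Local Open Scope card_scope.
Local Open Scope order_scope.

(** * Cardinals

    A cardinal is represented by any type having that cardinality; types are
    compared through their full sets. *)

Definition card_lt (K L : Type) : Prop :=
  [set: K] #<= [set: L] /\ ~ ([set: L] #<= [set: K]).

(* |L| is the least cardinal greater than |K|. *)
Definition is_card_succ (K L : Type) : Prop :=
  card_lt K L /\ forall C : Type, card_lt K C -> [set: L] #<= [set: C].

Fixpoint is_aleph (n : nat) (K : Type) : Prop :=
  match n with
  | 0 => [set: K] #= [set: nat]
  | m.+1 => exists L : Type, is_aleph m L /\ is_card_succ L K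
  end.

(* |K| is the supremum of the aleph_n, n < omega. *)
Definition is_aleph_omega (K : Type) : Prop :=
  exists L : nat -> Type,
    [/\ forall n, is_aleph n (L n),
        forall n, [set: L n] #<= [set: K] &
        forall C : Type,
          (forall n, [set: L n] #<= [set: C]) -> [set: K] #<= [set: C]].

(** * First-order structures and elementary substructures *)

Record signature := Signature {
  fsym : Type;
  farity : fsym -> nat;
  rsym : Type;
  rarity : rsym -> nat
}.

Definition countable_signature (S : signature) : Prop :=
  countable [set: fsym S] /\ countable [set: rsym S].

Inductive term (S : signature) : Type :=
| Var (x : nat)
| App (f : fsym S) (args : 'I_(farity f) -> term S).

Inductive formula (S : signature) : Type :=
| FEq (s t : term S)
| FRel (r : rsym S) (args : 'I_(rarity r) -> term S)
| FFalse
| FImp (phi psi : formula S)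
| FAll (x : nat) (phi : formula S).

Arguments Var {S} x.
Arguments FFalse {S}.

Record structure (S : signature) (A : Type) := Structure {
  finterp : forall f : fsym S, ('I_(farity f) -> A) -> A;
  rinterp : forall r : rsym S, ('I_(rarity r) -> A) -> Prop
}.

Fixpoint eval (S : signature) (A : Type) (M : structure S A)
    (e : nat -> A) (t : term S) : A :=
  match t with
  | Var x => e x
  | App f args => finterp M (fun i : 'I_(farity f) => eval M e (args i))
  end.

Definition update (A : Type) (e : nat -> A) (x : nat) (a : A) : nat -> A :=
  fun y => if y == x then a else e y.

Fixpoint sat (S : signature) (A : Type) (M : structure S A)
    (e : nat -> A) (phi : formula S) : Prop :=
  match phi with
  | FEq s t => eval M e s = eval M e t
  | FRel r args => rinterp M (fun i : 'I_(rarity r) => eval M e (args i))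
  | FFalse => False
  | FImp p q => sat M e p -> sat M e q
  | FAll x p => forall a : A, sat M (update e x a) p
  end.

Definition fun_closed (S : signature) (A : Type) (M : structure S A)
    (D : set A) : Prop :=
  forall (f : fsym S) (v : 'I_(farity f) -> A),
    (forall i, D (v i)) -> D (finterp M v).

Definition substructure (S : signature) (A : Type) (M : structure S A)
    (D : set A) (Dcl : fun_closed M D) : structure S (set_type D) :=
  @Structure S (set_type D)
    (fun f v => exist _ (finterp M (fun i : 'I_(farity f) => val (v i)))
       (mem_set (Dcl f _ (fun i => set_mem (valP (v i))))))
    (fun r v => rinterp M (fun i : 'I_(rarity r) => val (v i))).

Definition elementary_substructure (S : signature) (A : Type)
    (M : structure S A) (D : set A) : Prop :=
  exists Dcl : fun_closed M D,
    forall (phi : formula S) (e : nat -> set_type D),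
      sat (substructure Dcl) e phi <-> sat M (fun n => val (e n)) phi.

(** * Chang's conjecture (|K|, |L|) ->> (|M|, |N|)

    The distinguished subset of a structure is the interpretation of a unary
    relation symbol [u] of the signature. *)

Definition upred (S : signature) (A : Type) (M : structure S A)
    (u : rsym S) : set A :=
  [set a | rinterp M (fun _ : 'I_(rarity u) => a)].

Definition chang (K L M N : Type) : Prop :=
  forall (S : signature) (u : rsym S) (A : Type) (B : structure S A),
    countable_signature S -> rarity u = 1%N ->
    [set: A] #= [set: K] -> upred B u #= [set: L] ->
    exists D : set A,
      [/\ elementary_substructure B D,
          D #= [set: M] & D `&` upred B u #= [set: N]].

(** * The aleph_1-Freese-Nation property *)

(* Subsets of cardinality less than aleph_1 are the countable ones, finite
   ones included. *)
Definition aleph1_FN (d : Order.disp_t) (P : porderType d) : Prop :=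
  exists f : P -> set P,
    (forall p, countable (f p)) /\
    (forall p q : P, p <= q ->
       exists r : P, [/\ f p r, f q r, p <= r & r <= q]).

(** * The countably infinite subsets of X, ordered by inclusion *)

Definition ctblinf (X : Type) : Type :=
  set_type [set A : set X | A #= [set: nat]].

HB.instance Definition _ (X : Type) := SubChoice.on (ctblinf X).
HB.instance Definition _ (X : Type) :=
  [SubChoice_isSubPOrder of ctblinf X by <: with set_display].

Lemma ctblinf_leE (X : Type) (a b : ctblinf X) :
  (a <= b) = (val a `<=` val b) :> Prop.
Proof. by rewrite -Order.le_val subsetEset. Qed.

(* Main.v *)
(* Chang's conjecture is applied to a structure on aleph_{omega+1} in which
   - an element [a] codes a countable set [b a] of aleph_omega, and functions
     enumerate [b a] and (the codes of) the value [f (b a)] of an FN-map [f];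
   - the predecessors of each point for a suitable total relation [R] are mapped
     injectively into aleph_omega;
   - [s c] codes a set not contained in [b a] for any [R]-predecessor [a] of
     [c], which exists because aleph_omega countable sets are never cofinal.
   Let [D] be the substructure obtained and [X] its countable trace on
   aleph_omega. For [a] in [D] we have [b a <= X], so some [r] in the countable
   set [f X] with a code in [D] lies above [b a]. As [D] is uncountable with
   countable initial segments, the codes of these [r] are all [R]-below some [c]
   in [D], and then [s c], which lies in [D], codes a set below none of them. *)

Require Import Defs.
From HB Require Import structures.
From mathcomp Require Import all_boot all_order.
From mathcomp Require Import boolp classical_sets functions cardinality.
From mathcomp Require Import wochoice.

Local Open Scope classical_set_scope.
Local Open Scope card_scope.

(** * Comparing cardinalities through injections *)

Lemma card_le_inP (T U : Type) (u0 : U) (A : set T) :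
  A #<= [set: U] <-> exists f : T -> U, {in A &, injective f}.
Proof.
split=> [/card_leP[f]|[f f_inj]]; last first.
  apply: card_le_trans (card_leT (f @` A)).
  by case/card_eqPle: (inj_card_eq f_inj).
exists (fun x => if pselect (A x) is left Ax then
  val (f (exist _ x (mem_set Ax))) else u0).
move=> x y /set_mem Ax /set_mem Ay.
case: pselect => // Ax'; case: pselect => // Ay' /val_inj fxy.
by case: (inj (in_setT _) (in_setT _) fxy).
Qed.

Lemma card_image_inj (T U : Type) (f : T -> U) (A : set T) :
  injective f -> f @` A #= A.
Proof. by move=> f_inj; apply: inj_card_eq => x y _ _; exact: f_inj. Qed.

Lemma card_leTP (X T : Type) (A : set T) :
  [set: X] #<= A <-> exists f : X -> T, injective f /\ forall x, A (f x).
Proof.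
split=> [/card_leP[f]|[f [f_inj fA]]].
  exists (fun x => val (f (exist _ x (mem_set Logic.I)))); split=> [x y|x].
    by move=> /val_inj/(inj (in_setT _) (in_setT _))[].
  exact: set_mem (valP (f _)).
apply: card_le_trans (subset_card_le (_ : range f `<=` A)).
  by case/card_eqPle: (card_image_inj _ _ _ setT f_inj).
by move=> _ [x _ <-].
Qed.

Lemma card_leTTP (X Y : Type) :
  [set: X] #<= [set: Y] <-> exists f : X -> Y, injective f.
Proof.
by rewrite card_leTP; split=> [[f []]|[f f_inj]]; exists f.
Qed.

(* Zorn: a maximal partial bijection is total on one of the two sides. *)
Lemma card_le_total (X Y : Type) :
  [set: X] #<= [set: Y] \/ [set: Y] #<= [set: X].
Proof.
pose P := [set G : set (X * Y) |
  forall p q, G p -> G q -> p.1 = q.1 <-> p.2 = q.2].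
have [|G [PG Gmax]] := @Zorn_bigcup _ P.
  move=> F FP Ftot p q [G FG Gp] [H FH Hq].
  by case: (Ftot G H FG FH) => GH; [apply: (FP H)|apply: (FP G)] => //;
    apply: GH.
have [Xtot|] := pselect (forall x, exists y, G (x, y)).
  left; apply/card_leTTP; have [f fG] := choice Xtot; exists f => x x' fxx'.
  exact: (PG _ _ (fG x) (fG x')).2.
have [Ytot _|+] := pselect (forall y, exists x, G (x, y)).
  right; apply/card_leTTP; have [f fG] := choice Ytot; exists f => y y' fyy'.
  exact: (PG _ _ (fG y) (fG y')).1.
move=> /existsNP[y noy] /existsNP[x nox]; exfalso.
have [] := Gmax (G `|` [set (x, y)]).
  split=> [|sub]; first by move=> ?; left.
  by apply: nox; exists y; apply: sub; right.
move=> [a b] [a' b'] /= [Gp|[-> ->]] [Gq|[-> ->]] //=.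
- exact: (PG _ _ Gp Gq).
- by split=> E; subst; case: noy; [case: nox|]; eexists; exact: Gp.
- by split=> E; subst; case: noy; [case: nox|]; eexists; exact: Gq.
Qed.

(* A maximal family [D] of disjoint injective sequences covers all but finitely
   many points, so points are coded by [D * (nat + nat)]. *)
Lemma card_le_mul_nat (X : Type) :
  [set: nat] #<= [set: X] -> [set: X * nat] #<= [set: X].
Proof.
move=> Xinf.
have [D [Dinj Dtriv Dmax]] := ex_maximal_disjoint_subcollection
  (fun s : nat -> X => range s) [set s | injective s].
pose Q := [set x | forall s m, D s -> s m <> x].
(* An infinite [Q] would contain an injective sequence disjoint from all those in [D], against
   maximality. *)
have Qfin : finite_set Q.
  apply/finite_setPn => /card_leTP[s [s_inj Qs]].
  apply: (Dmax (D `|` [set s])).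
  - split=> [|sub]; first by move=> t; left.
    by apply: (Qs 0 s 0) => //; apply: sub; right.
  - by move=> t [/Dinj|->].
  - move=> t u [Dt|->] [Du|->] //.
    + exact: Dtriv.
    + by move=> [x [[m _ <-] [n _ /esym]]] /(Qs n t m Dt).
    + by move=> [x [[m _ <-] [n _]]] /(Qs m u n Du).
have [s0 Ds0] : exists s, D s.
  apply: contrapT => /forallNP D0; apply/finite_setPn: Xinf.
  by apply: sub_finite_set Qfin => x _ s m /D0.
have [e e_inj] := (card_le_inP _ _ 0 Q).1 (finite_set_countable Qfin).
have /choice[c cP] : forall x, exists p : (nat -> X) * (nat + nat), D p.1 /\
    match p.2 with inl m => p.1 m = x | inr k => Q x /\ e x = k end.
  move=> x; have [Qx|] := pselect (Q x); first by exists (s0, inr (e x)).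
  move=> /existsNP[s /existsNP[m /not_implyP[Ds /contrapT sm]]].
  by exists (s, inl m).
have c_inj : injective c.
  move=> x y cxy; move: (cP x) (cP y); rewrite cxy => -[_].
  case: (c y).2 => [m -> [] //|k [Qx <-] [_ [Qy]]] /esym.
  by apply: e_inj; rewrite inE.
(* Disjointness recovers the sequence from its value, and injectivity recovers the position. *)
apply/card_leTTP; exists (fun p => (c p.1).1 (pickle ((c p.1).2, p.2))).
move=> [x m] [y n] /= E.
have [Dx _] := cP x; have [Dy _] := cP y.
have Es : (c x).1 = (c y).1.
  apply: Dtriv => //; exists ((c x).1 (pickle ((c x).2, m))); split=> //.
  by exists (pickle ((c y).2, n)).
move: E; rewrite Es => /(Dinj _ Dy)/(pcan_inj pickleK)[Ec ->].
congr pair; apply: c_inj.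
by move: Es Ec; case: (c x) (c y) => [? ?] [? ?] /= -> ->.
Qed.

(** * The alephs and the cofinality of aleph_omega *)

Lemma card_lt_eq (K K' L L' : Type) : [set: K] #= [set: K'] ->
  [set: L] #= [set: L'] -> card_lt K L -> card_lt K' L'.
Proof.
move=> EK EL [KL LK]; split.
  by rewrite -(card_le_eql EK) -(card_le_eqr EL).
by rewrite -(card_le_eql EL) -(card_le_eqr EK).
Qed.

Lemma is_aleph_eq (n : nat) (K L : Type) :
  is_aleph n K -> is_aleph n L -> [set: K] #= [set: L].
Proof.
elim: n K L => [|n IH] K L /=.
  by move=> Kn Ln; apply: card_eq_trans (card_esym Ln).
move=> [K' [aK' [ltK minK]]] [L' [aL' [ltL minL]]].
have E := IH _ _ aK' aL'.
apply/card_eqPle; split; [apply: minK|apply: minL].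
  exact: card_lt_eq (card_esym E) (card_eqxx _) ltL.
exact: card_lt_eq E (card_eqxx _) ltK.
Qed.

Lemma is_aleph_infinite (n : nat) (K : Type) :
  is_aleph n K -> [set: nat] #<= [set: K].
Proof.
elim: n K => [|n IH] K /=; first by move=> /card_eqPle[].
by move=> [L [/IH natL [[LK _] _]]]; exact: card_le_trans LK.
Qed.

Lemma is_aleph1_uncountable (K : Type) : is_aleph 1 K -> ~ countable [set: K].
Proof.
move=> [L [Lnat [[_ KL] _]]] Kc; apply: KL; apply: card_le_trans Kc _.
by case/card_eqPle: Lnat.
Qed.

Lemma is_aleph_not_ge_omega (n : nat) (L K : Type) : is_aleph n L ->
  is_aleph_omega K -> ~ ([set: K] #<= [set: L]).
Proof.
move=> aL [A [aA AK _]] KL.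
have [L' [aL' [[_ ltL'] _]]] := aA n.+1.
apply: ltL'; apply: card_le_trans (AK n.+1) _; apply: card_le_trans KL _.
by case/card_eqPle: (is_aleph_eq _ _ _ aL aL').
Qed.

Lemma is_aleph_omega_infinite (K : Type) :
  is_aleph_omega K -> [set: nat] #<= [set: K].
Proof.
move=> [L [aL LK _]].
exact: card_le_trans (is_aleph_infinite _ _ (aL 0)) (LK 0).
Qed.

(* aleph_omega has cofinality omega: |F * nat| < |K| for each fibre [F] of
   [rank]. *)
Lemma aleph_omega_rank (K : Type) : is_aleph_omega K ->
  exists rank : K -> nat, forall (n : nat) (phi : K -> K * nat),
    injective phi -> exists x, rank (phi x).1 <> n.
Proof.
move=> Kw; have [L [aL _ minK]] := Kw.
(* Every [L n] embeds in the disjoint sum, hence so does their supremum [K]; the rank of a point is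
   the index of its summand. *)
have /card_leTTP[g g_inj] : [set: K] #<= [set: {n & L n}].
  apply: minK => n; apply/card_leTTP; exists (existT L n) => x y.
  exact: existT_inj2.
exists (fun x => projT1 (g x)) => n phi phi_inj.
apply: contrapT => /forallNP/(_ _)/contrapT rk.
have /choice[h hP] : forall x, exists y, g (phi x).1 = existT L n y.
  by move=> x; case: (g _) (rk x) => m y /= <-; exists y.
apply: (is_aleph_not_ge_omega n (L n) K (aL n) Kw).
apply: card_le_trans (card_le_mul_nat _ (is_aleph_infinite _ _ (aL n))).
apply/card_leTTP; exists (fun x => (h x, (phi x).2)) => x y [hxy Exy].
have E1 : (phi x).1 = (phi y).1 by apply: g_inj; rewrite !hP hxy.
by apply: phi_inj; move: E1 Exy; case: (phi x) (phi y) => [? ?] [? ?] /= -> ->.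
Qed.

(** * Countable subsets of aleph_omega *)

Lemma countable_range (T : Type) (x0 : T) (A : set T) :
  A x0 -> countable A -> exists e : nat -> T, range e = A.
Proof.
move=> Ax0 /(card_le_inP _ _ 0)[c c_inj].
have /choice[e eP] : forall n, exists x,
    A x /\ forall y, A y -> c y = n -> x = y.
  move=> n; have [[x [Ax <-]]|noA] := pselect (exists x, A x /\ c x = n).
    by exists x; split=> // y Ay /esym; apply: c_inj; rewrite inE.
  by exists x0; split=> // y Ay cy; case: noA; exists y.
exists e; apply/seteqP; split=> [_ [n _ <-]|x Ax]; first by have [] := eP n.
by exists (c x) => //; apply: (eP _).2.
Qed.

Lemma ctblinf_range (K : Type) (p : ctblinf K) :
  exists e : nat -> K, range e = val p.
Proof.
have /set_mem/= /card_eqPle[p_count /infiniteP/infinite_setN0[x px]] := valP p.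
exact: countable_range px p_count.
Qed.

(* Diagonal choice as in König's lemma: the countable sets [b i] whose index has
   rank [n] do not cover [K], so a point can be picked outside all of them. *)
Lemma ctblinf_not_cofinal (K I : Type) (S : set I) (b : I -> ctblinf K) :
  is_aleph_omega K -> S #<= [set: K] ->
  exists p : ctblinf K, forall i, S i -> ~ val p `<=` val (b i).
Proof.
move=> Kw SK; have [rank rankP] := aleph_omega_rank _ Kw.
have /card_leTTP[u u_inj] := is_aleph_omega_infinite _ Kw.
have [code code_inj] := (card_le_inP _ _ (u 0) S).1 SK.
have /choice[en enP] := fun i => ctblinf_range _ (b i).
have /choice[d dP] : forall n, exists x,
    forall i m, S i -> rank (code i) = n -> en i m <> x.
  move=> n; apply: contrapT => /forallNP cov.
  have /choice[c cP] : forall x, exists p : I * nat,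
      [/\ S p.1, rank (code p.1) = n & en p.1 p.2 = x].
    move=> x; have /existsNP[i /existsNP[m]] := cov x.
    by move=> /not_implyP[Si /not_implyP[rk /contrapT E]]; exists (i, m).
  have [|x []] := rankP n (fun x => (code (c x).1, (c x).2)).
    2: by have [] := cP x.
  move=> x y [E1 E2]; have [Sx _ <-] := cP x; have [Sy _ <-] := cP y.
  by rewrite E2 (code_inj _ _ _ _ E1) ?inE.
(* The diagonal points sit at odd positions; the injective [u] at even positions makes the range
   infinite. *)
pose w n := if odd n then d n./2 else u n./2.
have wnat : range w #= [set: nat].
  apply: eq_card_nat; first exact: card_image_le.
  apply/infiniteP/card_leTP; exists u; split=> // n.
  by exists n.*2; rewrite // /w odd_double doubleK.
exists (exist _ (range w) (mem_set wnat)) => i Si /= sub.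
suff : range (en i) (d (rank (code i))) by move=> [m _]; exact: dP.
rewrite enP; apply: sub; exists (rank (code i)).*2.+1 => //.
by rewrite /w /= odd_double /= uphalf_double.
Qed.

(** Well-order [M]. If some initial segment is larger than [K], the least such segment has at least
    the size of the successor [M], so [M] embeds in it and the order is pulled back along the
    embedding. *)
Lemma ex_rel_small_predecessors (K M : Type) : is_card_succ K M ->
  exists R : M -> M -> Prop,
    (forall x y, [\/ x = y, R x y | R y x]) /\
    forall y, [set x | R x y] #<= [set: K].
Proof.
elim/Peq : M => M [_ minM].
have [lew lewP] := well_ordering_principle M.
have min (A : set M) : A !=set0 -> exists2 z, A z & forall x, A x -> lew z x.
  move=> [x Ax]; have [|z [[/set_mem Az zmin] _]] := lewP (mem A).
    by exists x; rewrite inE.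
  by exists z => // y Ay; apply: zmin; rewrite inE.
have lew_xx x : lew x x by have [|z -> ] := min [set x]; [exists x | exact].
have lew_anti x y : lew x y -> lew y x -> x = y.
  move=> xy yx; have [|z [_ zu]] := lewP (mem [set x; y]).
    by exists x; rewrite inE; left.
  by rewrite -(zu x) ?(zu y) //; split; rewrite ?inE; (try by [left|right]);
    move=> t /set_mem[]->.
pose seg z := [set x | ~ lew z x].
have [f f_inj fsmall] : exists2 f : M -> M,
    injective f & forall y, seg (f y) #<= [set: K].
  have [small|] := pselect (forall z, seg z #<= [set: K]); first by exists id.
  move=> /existsNP/min[z zbig zmin].
  have /card_leTP[f [f_inj fz]] : [set: M] #<= seg z.
    rewrite -(card_le_eqr (card_setT _)); apply: minM; split; last first.
      by rewrite (card_le_eql (card_setT _)).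
    have [|//] := card_le_total (set_type (seg z)) K.
    by rewrite (card_le_eql (card_setT _)) => /zbig.
  by exists f => // y; apply: contrapT => /zmin; exact: fz.
exists (fun x y => seg (f y) (f x)); split=> [x y|y].
  rewrite /seg/=; have [yx|] := pselect (lew (f y) (f x)); last by constructor 2.
  have [xy|] := pselect (lew (f x) (f y)); last by constructor 3.
  by constructor 1; apply/f_inj/lew_anti.
apply: card_le_trans (fsmall y).
apply: card_le_trans (subset_card_le (_ : f @` (f @^-1` seg (f y)) `<=` _)).
  by case/card_eqPle: (card_image_inj _ _ _ (f @^-1` seg (f y)) f_inj).
by move=> _ [x + <-].
Qed.

(* Closing under arbitrary binary functions is all that the argument needs of
   elementarity: the functions are taken as symbols of the signature. *)
Lemma chang_closed (K L M N : Type) (F : countType) (g : F -> K -> K -> K)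
    (U : set K) : chang K L M N -> U #= [set: L] ->
  exists D : set K, [/\ forall i x y, D x -> D y -> D (g i x y),
    D #= [set: M] & D `&` U #= [set: N]].
Proof.
move=> KLMN UL.
pose S := @Signature F (fun=> 2%N) unit (fun=> 1%N).
pose B := @Structure S K (fun i v => g i (v ord0) (v ord_max))
  (fun _ v => U (v ord0)).
have [] := KLMN S tt K B => //.
  by split; apply: countableP.
move=> D [[Dcl _] DM DU]; exists D; split=> // i x y Dx Dy.
have := Dcl i (fun j : 'I_2 => if j == ord0 then x else y); apply.
by move=> j; case: ifP.
Qed.

Theorem theorem4p1 (aleph_1 aleph_w aleph_w1 : Type)
    (aleph_1P : is_aleph 1 aleph_1)
    (aleph_wP : is_aleph_omega aleph_w)
    (aleph_w1P : is_card_succ aleph_w aleph_w1)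
    (aleph_w_pow : [set: nat -> aleph_w] #= [set: aleph_w1])
    (chang_conj : chang aleph_w1 aleph_w aleph_1 nat) :
  ~ aleph1_FN (ctblinf aleph_w).
Proof.
move=> [f [f_count fP]].
have /card_leTTP[u u_inj] := is_aleph_omega_infinite _ aleph_wP.
have [[aleph_w_le _] _] := aleph_w1P.
have /card_leTTP[iota iota_inj] := aleph_w_le.
have [R [R_total R_small]] := ex_rel_small_predecessors _ _ aleph_w1P.
have /choice[en enP] := @ctblinf_range aleph_w.
(* A countable set is determined by an enumeration of it, so [aleph_w_pow] bounds their number. *)
have /card_leTTP[idx idx_inj] : [set: ctblinf aleph_w] #<= [set: aleph_w1].
  case/card_eqPle: aleph_w_pow => + _; apply: card_le_trans.
  apply/card_leTTP; exists en => p q /(congr1 (fun e => range e)).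
  by rewrite !enP => /val_inj.
(* [b] decodes [idx], with the default value [range u] on points that code nothing. *)
have /choice[b bP] : forall a, exists p : ctblinf aleph_w,
    forall q, idx q = a -> p = q.
  move=> a; have [[p <-]|noa] := pselect (exists p, idx p = a).
    by exists p => q /idx_inj.
  have u_nat : range u #= [set: nat] by exact: card_image_inj.
  by exists (exist _ (range u) (mem_set u_nat)) => q ja; case: noa; exists q.
have idxK p : b (idx p) = p by exact: bP.
have /choice[fe feP] : forall p, exists e : nat -> ctblinf aleph_w,
    range e = f p.
  (* The FN property for [p <= p] makes [f p] nonempty. *)
  move=> p; have [r [fpr _ _ _]] := fP p p (Order.le_refl p).
  exact: countable_range fpr (f_count p).
have /choice[h hP] : forall c, exists h : aleph_w1 -> aleph_w,
    {in [set x | R x c] &, injective h}.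
  by move=> c; apply/(card_le_inP _ _ (u 0)).
have /choice[s sP] : forall c, exists p : ctblinf aleph_w,
    forall a, R a c -> ~ val p `<=` val (b a).
  by move=> c; exact: (ctblinf_not_cofinal _ _ _ b aleph_wP (R_small c)).
(* The distinguished set is [range iota], a copy of aleph_omega; only [h] uses both arguments. *)
pose g (i : nat + nat + bool) (x y : aleph_w1) := match i with
  | inl (inl n) => iota (en (b x) n)
  | inl (inr n) => idx (fe (b x) n)
  | inr true => iota (h x y)
  | inr false => idx (s x)
  end.
have [|D [Dcl D1 D0]] := @chang_closed _ _ _ _ (nat + nat + bool)%type g
    (range iota) chang_conj; first exact: card_image_inj.
have X_nat : (iota @^-1` D) #= [set: nat].
  apply: card_eq_trans D0; apply: card_esym.
  have -> : D `&` range iota = iota @` (iota @^-1` D).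
    apply/seteqP; split=> [y [Dy [x _ E]]|_ [x Dx <-]]; last by split.
    by exists x; rewrite // /preimage/= E.
  exact: card_image_inj.
pose X : ctblinf aleph_w := exist _ (iota @^-1` D) (mem_set X_nat).
have b_sub_X a : D a -> (b a <= X)%O.
  move=> Da; rewrite ctblinf_leE /= -enP => _ [n _ <-].
  exact: (Dcl (inl (inl n)) a a).
have cof a : D a -> exists r, [/\ f X r, D (idx r) & val (b a) `<=` val r].
  move=> Da; have [r [far fXr ar _]] := fP _ _ (b_sub_X a Da).
  exists r; split=> //; last by rewrite -ctblinf_leE.
  by move: far; rewrite -feP => -[n _ <-]; exact: (Dcl (inl (inr n)) a a).
pose C := D `&` (idx @` f X).
have C_count : countable C.
  apply: card_le_trans (card_le_trans (card_image_le idx _) (f_count X)).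
  by apply: subset_card_le => x [].
(* Otherwise [D] would be a countable union of countable initial segments. *)
have [c Dc cP] : exists2 c, D c & forall a, C a -> R a c.
  apply: contrapT => unb; apply: (is_aleph1_uncountable _ aleph_1P).
  rewrite -(eq_countable D1).
  (* As no point of [D] bounds [C], totality of [R] puts each one in [C] or [R]-below a member of
     [C]. *)
  pose E (i : bool) :=
    if i then C else \bigcup_(c in C) (D `&` [set x | R x c]).
  apply: (@sub_countable _ _ _ (\bigcup_i E i)).
    apply: subset_card_le => x Dx.
    have [Cx|nCx] := pselect (C x); first by exists true.
    have [c Cc nR] : exists2 c, C c & ~ R c x.
      apply: contrapT => noc; apply: unb; exists x => // c Cc.
      by apply: contrapT => nR; apply: noc; exists c.
    exists false => //; exists c => //; split=> //=.
    by case: (R_total c x) => // cx; case: nCx; rewrite -cx.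
  apply: bigcup_countable => // -[] _ //=.
  apply: bigcup_countable => // c [Dc _].
  (* [iota \o h c] embeds this segment into the countable trace of [D] on [range iota]. *)
  have {}hP : {in D `&` [set x | R x c] &, injective (iota \o h c)}.
    move=> x y /set_mem[_ Rx] /set_mem[_ Ry] /iota_inj.
    by apply: hP; rewrite inE.
  have /card_eqPle[_ /card_le_trans] := inj_card_eq hP; apply.
  case/card_eqPle: D0 => + _; apply: card_le_trans; apply: subset_card_le.
  move=> _ [x [Dx _] <-]; split; last by exists (h c x).
  exact: (Dcl (inr true) c x).
(* For the code of [s c] this yields [r] above [s c], while [idx r] lies in [C] and so [R]-below
   [c]. *)
have [r [fXr Dr]] := cof _ (Dcl (inr false) c c Dc Dc).
rewrite /g idxK -(idxK r); apply: sP.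
by apply: cP; split=> //; exists r.
Qed.
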